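(* Let $M$ be an ada. Then there exists a bijection between the sets $\mathscr{A}(M)\cap M_{\#}^{c}$ and $\mathscr{A}(M)\cap M_{\#}$.
   Context: A $C$-algebra is an algebra $\langle M,\vee,\wedge,\neg\rangle$ of type $(2,2,1)$ satisfying, for all $\alpha,\beta,\gamma$: $\neg\neg\alpha=\alpha$; $\neg(\alpha\wedge\beta)=\neg\alpha\vee\neg\beta$; $(\alpha\wedge\beta)\wedge\gamma=\alpha\wedge(\beta\wedge\gamma)$; $\alpha\wedge(\beta\vee\gamma)=(\alpha\wedge\beta)\vee(\alpha\wedge\gamma)$; $(\alpha\vee\beta)\wedge\gamma=(\alpha\wedge\gamma)\vee(\neg\alpha\wedge\beta\wedge\gamma)$; $\alpha\vee(\alpha\wedge\beta)=\alpha$; $(\alpha\wedge\beta)\vee(\beta\wedge\alpha)=(\beta\wedge\alpha)\vee(\alpha\wedge\beta)$. A $C$-algebra with $T,F,U$ has nullary operations $T,F,U$: $T$ is the two-sided identity for $\wedge$, $F$ the two-sided identity for $\vee$, $U$ the fixed point of $\neg$. An ada is a $C$-algebra with $T,F,U$ together with a unary operation $(\cdot)^{\downarrow}$ satisfying $F^{\downarrow}=F$, $U^{\downarrow}=F$, $T^{\downarrow}=T$, $\alpha\wedge\beta^{\downarrow}=\alpha\wedge(\alpha\wedge\beta)^{\downarrow}$, $\alpha^{\downarrow}\vee\neg(\alpha^{\downarrow})=T$, $\alpha=\alpha^{\downarrow}\vee\alpha$. $M_{\#}=\{\alpha\in M:\alpha\vee\neg\alpha=T\}$ and $M_\#^c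 = M\setminus M_\#$. Order: $a\leq b$ iff $a\vee b=b$. An atom is $a\neq F$ such that every $b$ with $F\leq b\leq a$, $b\neq a$ equals $F$; $\mathscr{A}(M)$ is the set of atoms of $M$. *)

(* Defs.v *)
From HB Require Import structures.
From mathcomp Require Import all_boot.
From mathcomp Require Import classical_sets functions.

Set Implicit Arguments.
Unset Strict Implicit.
Unset Printing Implicit Defensive.

Local Open Scope classical_set_scope.

Reserved Notation "\neg a" (at level 35, right associativity).
Reserved Notation "a \wedge b" (at level 40, left associativity).
Reserved Notation "a \vee b" (at level 50, left associativity).
Reserved Notation "a ^down" (at level 1, format "a ^down").

Declare Scope calg_scope.
Delimit Scope calg_scope with calg.
Local Open Scope calg_scope.

HB.mixin Record isCAlgebra M := {
  cor : M -> M -> M;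
  cand : M -> M -> M;
  cneg : M -> M;
  cnegK : forall a, cneg (cneg a) = a;
  cneg_and : forall a b, cneg (cand a b) = cor (cneg a) (cneg b);
  candA : forall a b c, cand (cand a b) c = cand a (cand b c);
  cand_orr : forall a b c, cand a (cor b c) = cor (cand a b) (cand a c);
  cand_orl : forall a b c,
    cand (cor a b) c = cor (cand a c) (cand (cand (cneg a) b) c);
  cor_absorb : forall a b, cor a (cand a b) = a;
  cor_andC : forall a b,
    cor (cand a b) (cand b a) = cor (cand b a) (cand a b)
}.

#[short(type="cAlgebraType")]
HB.structure Definition CAlgebra := { M of isCAlgebra M }.

Notation "\neg a" := (cneg a) : calg_scope.
Notation "a \wedge b" := (cand a b) : calg_scope.
Notation "a \vee b" := (cor a b) : calg_scope.

(* Two-sided identities are unique, and [cneg_U] with the other axioms forces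
   [cU] to be the only fixed point of [cneg]. *)
HB.mixin Record CAlgebra_hasTFU M of CAlgebra M := {
  cT : M;
  cF : M;
  cU : M;
  candTx : forall a : M, cT \wedge a = a;
  candxT : forall a : M, a \wedge cT = a;
  corFx : forall a : M, cF \vee a = a;
  corxF : forall a : M, a \vee cF = a;
  cneg_U : \neg cU = cU
}.

#[short(type="cAlgebraTFUType")]
HB.structure Definition CAlgebraTFU := { M of CAlgebra_hasTFU M & CAlgebra M }.

HB.mixin Record CAlgebraTFU_isAda M of CAlgebraTFU M := {
  down : M -> M;
  downF : down cF = cF;
  downU : down cU = cF;
  downT : down cT = cT;
  cand_down : forall a b : M, a \wedge down b = a \wedge down (a \wedge b);
  down_compl : forall a : M, down a \vee \neg (down a) = cT;
  cor_down : forall a : M, a = down a \vee a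
}.

#[short(type="adaType")]
HB.structure Definition Ada := { M of CAlgebraTFU_isAda M & CAlgebraTFU M }.

Notation "a ^down" := (down a) : calg_scope.

Definition cle (M : cAlgebraType) (a b : M) : Prop := a \vee b = b.

Definition is_atom (M : cAlgebraTFUType) (a : M) : Prop :=
  a <> cF /\ (forall b : M, cle cF b -> cle b a -> b <> a -> b = cF).

Definition atoms (M : cAlgebraTFUType) : set M := [set a | is_atom a].

Definition Msharp (M : cAlgebraTFUType) : set M := [set a | a \vee \neg a = cT].

Arguments atoms : clear implicits.
Arguments Msharp : clear implicits.

(* Main.v *)
Require Import Defs.
From mathcomp Require Import all_boot.
From mathcomp Require Import classical_sets functions.
From Corelib Require Import Setoid Morphisms.

(** Left conjunction with a fixed [e] is compatible with all the operations, so
    [e \wedge x = e \wedge y] is a congruence, "x and y agree on e".  Each [a]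
    agrees with [T] on [a^down], with [F] on [(\neg a)^down] and with [U] on
    the complement of both, so identities can be checked by cases as in the
    three-element ada.  There, [a <= b] means that [a] is pointwise [F] or
    equal to [b], so an atom is constantly [T] or constantly [U] on a minimal
    part and [F] elsewhere; the bijection replaces the value [U] by [T]. *)

Set Implicit Arguments.
Unset Strict Implicit.
Unset Printing Implicit Defensive.

Local Open Scope classical_set_scope.
Local Open Scope calg_scope.

(** * Identities of C-algebras with constants *)

Section CAlgebraTFU.
Variable M : cAlgebraTFUType.
Implicit Types a b c e s x y : M.

Lemma cneg_or a b : \neg (a \vee b) = \neg a \wedge \neg b.
Proof. by rewrite -{1}(cnegK a) -{1}(cnegK b) -cneg_and cnegK. Qed.

Lemma cnegT : \neg (cT : M) = cF.
Proof.
by rewrite -[LHS]corxF -(cnegK cF) -cneg_and candTx.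
Qed.

Lemma cnegF : \neg (cF : M) = cT.
Proof. by rewrite -cnegT cnegK. Qed.

Lemma candFx a : cF \wedge a = cF.
Proof. by rewrite -[LHS]corFx cor_absorb. Qed.

Lemma corTx a : cT \vee a = cT.
Proof. by rewrite -(cnegK (cT \vee a)) cneg_or cnegT candFx cnegF. Qed.

Lemma cor_idem a : a \vee a = a.
Proof. by rewrite -{2}(candxT a) cor_absorb. Qed.

Lemma cand_idem a : a \wedge a = a.
Proof. by rewrite -(cnegK (a \wedge a)) cneg_and cor_idem cnegK. Qed.

Lemma cand_absorb a b : a \wedge (a \vee b) = a.
Proof.
by rewrite -(cnegK (a \wedge _)) cneg_and (cneg_or a) cor_absorb cnegK.
Qed.

Lemma cor_negl a b : a \vee (\neg a \wedge b) = a \vee b.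
Proof. by rewrite -[RHS]candxT cand_orl !candxT. Qed.

Lemma cand_negl a b : a \wedge (\neg a \vee b) = a \wedge b.
Proof.
rewrite -(cnegK (a \wedge _)) cneg_and (cneg_or (\neg a) b) cor_negl.
by rewrite -cneg_and cnegK.
Qed.

Lemma corA a b c : (a \vee b) \vee c = a \vee (b \vee c).
Proof. by rewrite -[LHS]cnegK !cneg_or candA -!cneg_or cnegK. Qed.

Lemma candUx a : cU \wedge a = cU.
Proof. by rewrite -cand_negl cneg_U cand_absorb. Qed.

Lemma corUx a : cU \vee a = cU.
Proof. by rewrite -[LHS]cnegK cneg_or cneg_U candUx cneg_U. Qed.

(** The commutation axiom swaps [a \wedge cU] with [cU \wedge a = cU], which then absorbs on the
    left. *)
Lemma cand_U_or_U a : (a \wedge cU) \vee cU = cU.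
Proof. by rewrite -{2}(candUx a) cor_andC candUx corUx. Qed.

(** * Agreement on an element, and splitting along sharp elements *)

Definition agree e x y := e \wedge x = e \wedge y.
Local Notation "x =[ e ] y" := (agree e x y)
  (at level 70, e at level 60, format "x  =[ e ]  y").

Global Instance agree_equiv e : Equivalence (agree e).
Proof. by split=> [x|x y|x y z]; rewrite /agree => // -> . Qed.

Global Instance agree_or e :
  Proper (agree e ==> agree e ==> agree e) (@cor M).
Proof. by move=> x x' xx' y y' yy'; rewrite /agree !cand_orr xx' yy'. Qed.

(** By [cand_negl], [e \wedge \neg x] equals [e \wedge \neg (e \wedge x)], so it depends only on
    [e \wedge x]. *)
Global Instance agree_neg e : Proper (agree e ==> agree e) (@cneg M).
Proof.
move=> x y xy; rewrite /agree -(cand_negl e (\neg x)) -cneg_and xy.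
by rewrite cneg_and cand_negl.
Qed.

Global Instance agree_and e :
  Proper (agree e ==> agree e ==> agree e) (@cand M).
Proof.
move=> x x' xx' y y' yy'.
rewrite -(cnegK (x \wedge y)) -(cnegK (x' \wedge y')) !cneg_and.
by rewrite xx' yy'.
Qed.

Lemma agreeT x y : x =[cT] y -> x = y.
Proof. by rewrite /agree !candTx. Qed.

Lemma agree_self e : e =[e] cT.
Proof. by rewrite /agree cand_idem candxT. Qed.

(** Closes contradictory cases: where two distinct constants agree, everything collapses. *)
Lemma agree_TF e x y : cT =[e] cF -> x =[e] y.
Proof. by move=> TF; rewrite -(candTx x) -(candTx y) TF !candFx. Qed.

Lemma agree_UF e x y : cU =[e] cF -> x =[e] y.
Proof.
by move=> UF; apply: agree_TF; rewrite -UF -cneg_U UF cnegF.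
Qed.

Lemma agree_UT e x y : cU =[e] cT -> x =[e] y.
Proof. by move=> UT; apply: agree_UF; rewrite -{1}cneg_U UT cnegT. Qed.

(** This form of [e] lying inside [f] composes across nested case splits and carries agreements on
    [f] over to [e]. *)
Definition refines e f := forall x y, x =[f] y -> x =[e] y.

Lemma refines_trans e f g : refines e f -> refines f g -> refines e g.
Proof. by move=> ef fg x y /fg/ef. Qed.

Lemma refines_andl f e : refines (f \wedge e) f.
Proof.
move=> x y xy; rewrite /agree !candA; change (e \wedge x =[f] e \wedge y).
by rewrite xy.
Qed.

Lemma refines_andr f e : refines (f \wedge e) e.
Proof. by move=> x y xy; rewrite /agree !candA xy. Qed.

(** Writing [cT] as [s \vee \neg s] splits [f] into [f \wedge s] and [f \wedge \neg s], on each of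
    which [s] is constant. *)
Lemma sharp_case s f x y : s \vee \neg s = cT ->
  (forall e, refines e f -> s =[e] cT -> x =[e] y) ->
  (forall e, refines e f -> s =[e] cF -> x =[e] y) -> x =[f] y.
Proof.
move=> sT caseT caseF.
have split z : f \wedge z = (f \wedge s \wedge z) \vee (f \wedge \neg s \wedge z).
  by rewrite -{1}(candTx z) -sT cand_orl cand_orr cand_idem !candA.
rewrite /agree (split x) (split y); congr cor.
- apply: caseT; first exact: refines_andl.
  exact/refines_andr/agree_self.
- apply: caseF; first exact: refines_andl.
  apply: (@refines_andr f (\neg s)).
  by have := agree_neg (agree_self (\neg s)); rewrite cnegK cnegT.
Qed.

Lemma sharp_neg s : s \vee \neg s = cT -> \neg s \vee \neg \neg s = cT.
Proof.
move=> sT; apply/agreeT; apply: (sharp_case sT) => e _ ->.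
- by rewrite cnegT cnegF corFx.
- by rewrite cnegF corTx.
Qed.

Lemma sharp_and_le s x : s \vee \neg s = cT -> cle (s \wedge x) x.
Proof.
move=> sT; apply/agreeT; apply: (sharp_case sT) => e _ ->.
- by rewrite candTx cor_idem.
- by rewrite candFx corFx.
Qed.

End CAlgebraTFU.

Local Notation "x =[ e ] y" := (agree e x y)
  (at level 70, e at level 60, format "x  =[ e ]  y").

(** * Three-valued case analysis and supports in an ada *)

Section Ada.
Variable M : adaType.
Implicit Types a b c e p s x y : M.

Global Instance agree_down e : Proper (agree e ==> agree e) (@Defs.down M).
Proof. by move=> x y; rewrite /agree => xy; rewrite cand_down xy -cand_down. Qed.

Lemma cand_down_self a : a \wedge a^down = a.
Proof. by rewrite -{2}(candxT a) -cand_down downT candxT. Qed.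

(* [a = a \wedge a^down] gives [a = a \wedge F] and dually [a = a \vee T], and
   commuting [a \wedge U] with [U \wedge a = U] leaves only [a = U]. *)
Lemma agreeU e a : a^down =[e] cF -> (\neg a)^down =[e] cF -> a =[e] cU.
Proof.
move=> aF naF.
have a_and : a =[e] a \wedge cF by rewrite -{1}(cand_down_self a) aF.
have a_or : a =[e] a \vee cT.
  by rewrite -{1}(cnegK a) -(cand_down_self (\neg a)) naF cneg_and cnegK cnegF.
have aU : a \wedge cU =[e] a.
  by rewrite {1}a_and candA candFx -a_and.
transitivity (a \vee cU).
  by rewrite {2}a_or corA corTx.
by rewrite -{1}aU cand_U_or_U.
Qed.

Lemma agree_downT e a : a^down =[e] cT -> a =[e] cT.
Proof. by move=> aT; rewrite (cor_down a) aT corTx. Qed.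

Lemma agree_neg_downT e a : (\neg a)^down =[e] cT -> a =[e] cF.
Proof. by move=> /agree_downT naT; rewrite -(cnegK a) naT cnegT. Qed.

Lemma ada_case a f x y :
  (forall e, refines e f -> a =[e] cT -> x =[e] y) ->
  (forall e, refines e f -> a =[e] cF -> x =[e] y) ->
  (forall e, refines e f -> a =[e] cU -> x =[e] y) -> x =[f] y.
Proof.
move=> caseT caseF caseU.
apply: (sharp_case (down_compl a)) => e ef a1.
  by apply: caseT => //; apply: agree_downT.
apply: (sharp_case (down_compl (\neg a))) => g ge a2.
  by apply: caseF; [exact: refines_trans ef|apply: agree_neg_downT].
apply: caseU; first exact: refines_trans ef.
by apply: agreeU => //; apply: ge.
Qed.

(* [T] where [a] is [T] or [U], and [F] where [a] is [F]. *)
Definition supp a := \neg ((\neg a)^down).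

Lemma supp_sharp a : supp a \vee \neg supp a = cT.
Proof. exact/sharp_neg/down_compl. Qed.

Lemma supp_eqF a : supp a = cF -> a = cF.
Proof.
move=> /(congr1 (@cneg M)); rewrite cnegK cnegF => aT.
by apply/agreeT/agree_neg_downT; rewrite aT.
Qed.

(** Makes [p \wedge cU] a preimage of [p] under [supp], for surjectivity. *)
Lemma supp_andU p : p \vee \neg p = cT -> supp (p \wedge cU) = p.
Proof.
rewrite /supp => pT; apply/agreeT; apply: (sharp_case pT) => e _ ->.
- by rewrite candTx cneg_U downU cnegF.
- by rewrite candFx cnegF downT cnegT.
Qed.

(** * From nonsharp atoms to sharp atoms *)

Lemma andU_eqF b : b \wedge cU = cF -> b = cF.
Proof.
move=> bU; apply/agreeT; apply: (@ada_case b) => e _ be //.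
- by apply: agree_UF; rewrite -bU be candTx.
- by rewrite be -bU be candUx.
Qed.

Lemma le_sharp_eq p b : p \vee \neg p = cT -> cle b p ->
  b \wedge cU = p \wedge cU -> b = p.
Proof.
rewrite /cle => pT bp bU; apply/agreeT.
apply: (sharp_case pT) => e _ pe; last first.
  by rewrite -{1}(corxF b) -pe bp.
apply: (@ada_case b) => g ge be; move/ge: pe => pe.
- by rewrite be pe.
- by apply: agree_UF; rewrite -(candTx cU) -pe -bU be candFx.
(* Since [cU] absorbs on the left, [b \vee p = p] forces [p] to be [cU] here too. *)
- by rewrite be -bp be corUx.
Qed.

Lemma le_andU p b : p \vee \neg p = cT -> cle b p -> cle (b \wedge cU) (p \wedge cU).
Proof.
rewrite /cle => pT bp; apply/agreeT.
apply: (sharp_case pT) => e _ pe.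
  by rewrite pe candTx cand_U_or_U.
have bF : b =[e] cF by rewrite -{1}(corxF b) -pe bp.
by rewrite bF pe candFx corxF.
Qed.

(** The sharp element [a^down] lies below the atom [a] and differs from it, hence is [cF]: [a]
    nowhere takes the value [cT]. *)
Lemma nonsharp_atom a : is_atom a -> a \vee \neg a <> cT ->
  a = supp a \wedge cU.
Proof.
move=> [_ amin] aNs.
have da : a^down \wedge a = a^down by rewrite {2}(cor_down a) cand_absorb.
have daF : a^down = cF.
  apply: amin; first exact: corFx.
    by rewrite -da; apply/sharp_and_le/down_compl.
  by move=> daa; apply: aNs; rewrite -daa down_compl.
apply/agreeT; apply: (sharp_case (down_compl (\neg a))) => e _ ae.
- by rewrite /supp ae cnegT candFx; apply: agree_neg_downT.
- by rewrite /supp ae cnegF candTx; apply: agreeU => //; rewrite daF.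
Qed.

(** If [b] is below [supp a], then [b \wedge cU] is below [supp a \wedge cU = a], where minimality
    applies; [andU_eqF] and [le_sharp_eq] bring the result back to [b]. *)
Lemma supp_atom a : is_atom a -> a \vee \neg a <> cT -> is_atom (supp a).
Proof.
move=> aA aNs; have aE := nonsharp_atom aA aNs; have sS := supp_sharp a.
have [aF amin] := aA; split=> [/supp_eqF//|b _ bs bNs].
apply/andU_eqF/amin; first exact: corFx.
  by rewrite aE; apply: le_andU.
by move=> bU; apply/bNs/le_sharp_eq => //; rewrite bU.
Qed.

(** * From sharp atoms to nonsharp atoms *)

Lemma sharp_atom_andU_nonsharp p : is_atom p -> p \vee \neg p = cT ->
  (p \wedge cU) \vee \neg (p \wedge cU) <> cT.
Proof.
move=> [pF _] pT UT; apply: pF.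
have pU e : p =[e] cT -> cU =[e] cT.
  by move=> pe; rewrite -UT pe candTx cneg_U corUx.
(* As [cU] and [cT] agree on [p], so do [p] and [\neg p]; thus [p = p \wedge \neg p], which is [cF]
   for sharp [p]. *)
have := agree_UT p (\neg p) (pU _ (agree_self p)); rewrite /agree cand_idem => ->.
rewrite -(cnegK (p \wedge _)) cneg_and.
by rewrite sharp_neg // cnegT.
Qed.

Lemma le_andU_supp p b : p \vee \neg p = cT -> cle b (p \wedge cU) ->
  cle (supp b) p.
Proof.
rewrite /cle => pT bp; apply/agreeT.
apply: (sharp_case pT) => e _ pe.
  rewrite pe; apply: (sharp_case (supp_sharp b)) => g _ ->.
    by rewrite corTx.
  by rewrite corFx.
have bF : b =[e] cF by rewrite -{1}(corxF b) -(candFx cU) -pe bp.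
by rewrite /supp bF pe corxF cnegF downT cnegT.
Qed.

Lemma le_andU_eq p b : p \vee \neg p = cT -> cle b (p \wedge cU) ->
  supp b = p -> b = p \wedge cU.
Proof.
rewrite /cle => pT bp sb; apply/agreeT.
apply: (sharp_case pT) => e _ pe; last first.
  by rewrite -{1}(corxF b) -{1}(candFx cU) -pe bp.
rewrite pe candTx; apply: (@ada_case b) => g ge be //; move/ge: pe => pe.
(* Here [b \vee cU] is [cT] because [b] is, and [cU] because [b] is below [p \wedge cU]. *)
- by rewrite -(candTx cU) -pe -bp be corTx.
- by apply: agree_TF; rewrite -pe -sb /supp be cnegF downT cnegT.
Qed.

(** Minimality of [p] is applied to [supp b], which lies below [p] and determines [b] when it is
    [cF] or [p]. *)
Lemma sharp_atom_andU p : is_atom p -> p \vee \neg p = cT ->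
  is_atom (p \wedge cU).
Proof.
move=> [pF pmin] pT; split=> [/andU_eqF//|b _ bp bNp].
apply/supp_eqF/pmin; first exact: corFx.
  exact: le_andU_supp.
by move=> sb; apply/bNp/le_andU_eq.
Qed.

End Ada.

Theorem theorem2p28 (M : adaType) :
  exists f : M -> M,
    set_bij (atoms M `&` ~` Msharp M) (atoms M `&` Msharp M) f.
Proof.
exists (@supp M); split.
- by move=> a [aA aNs]; split; [exact: supp_atom|exact: supp_sharp].
(* Injectivity: a nonsharp atom is recovered from its support by meeting with [cU]. *)
- move=> a b /set_mem[aA aNs] /set_mem[bA bNs] ab.
  by rewrite (nonsharp_atom aA aNs) ab -(nonsharp_atom bA bNs).
- move=> p [pA pT]; exists (p \wedge cU); last exact: supp_andU.
  by split; [exact: sharp_atom_andU|exact: sharp_atom_andU_nonsharp].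
Qed.
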